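(* Let $n\ge 5$ be an integer, let $R=\mathbb{C}[x,y,z,w]$, and let $I_n\subseteq R$ be the ideal generated by $$(x^n-y^n)(z^n-w^n)xy,\ (x^n-y^n)(z^n-w^n)zw,\ (x^n-z^n)(y^n-w^n)xz,\ (x^n-z^n)(y^n-w^n)yw,\ (x^n-w^n)(y^n-z^n)xw,\ (x^n-w^n)(y^n-z^n)yz.$$ Then $\alpha(I_n^{(m)})=2nm$ for all integers $m\ge 3$.
   Context: For a homogeneous ideal $I$, $\alpha(I)$ denotes the least degree of a nonzero homogeneous element of $I$. The $m$-th symbolic power is $I^{(m)}=\bigcap_{\mathfrak p\in \operatorname{Ass}(R/I)} (I^mR_{\mathfrak p}\cap R)$. *)

(* Defs.v *)
From HB Require Import structures.
From mathcomp Require Import all_boot all_algebra.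
From mathcomp Require Import mpoly.
From mathcomp Require Import complex.
From mathcomp Require Import Rstruct.

Set Implicit Arguments.
Unset Strict Implicit.
Unset Printing Implicit Defensive.

Import GRing.Theory.
Local Open Scope ring_scope.

(* The field of complex numbers: C = R[i] with R the Stdlib (classical) reals,
   which carry an rcfType structure via Rstruct. *)
Notation CC := (complex Rdefinitions.R).

Notation Rxyzw := {mpoly CC[4]}.

Section Ideals.
Variable A : comNzRingType.

Local Notation subsetA := (A -> Prop).

Definition ideal_gen (S : subsetA) : subsetA :=
  fun f => exists (k : nat) (c g : 'I_k -> A),
      (forall i, S (g i)) /\ f = \sum_(i < k) c i * g i.

Definition ideal_of_seq (s : seq A) : subsetA :=
  ideal_gen (fun g => g \in s).

Definition ideal_mul (I J : subsetA) : subsetA :=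
  ideal_gen (fun h => exists a b, I a /\ J b /\ h = a * b).

Fixpoint ideal_pow (I : subsetA) (m : nat) : subsetA :=
  match m with
  | 0%N => fun _ => True
  | m'.+1 => ideal_mul (ideal_pow I m') I
  end.

Definition is_ideal (I : subsetA) : Prop :=
  I 0 /\ (forall a b, I a -> I b -> I (a + b)) /\ (forall r a, I a -> I (r * a)).

Definition is_prime_ideal (P : subsetA) : Prop :=
  is_ideal P /\ ~ P 1 /\ (forall a b, P (a * b) -> P a \/ P b).

Definition associated_prime (I P : subsetA) : Prop :=
  is_prime_ideal P /\ exists g : A, forall f, P f <-> I (f * g).

(* m-th symbolic power: intersection over p in Ass(A/I) of I^m A_p \cap A;
   f lies in I^m A_p \cap A iff s f \in I^m for some s \notin p. *)
Definition symbolic_power (I : subsetA) (m : nat) : subsetA :=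
  fun f => forall P, associated_prime I P ->
      exists s, ~ P s /\ ideal_pow I m (s * f).

End Ideals.

Definition alpha_is (n : nat) (K : comNzRingType) (J : {mpoly K[n]} -> Prop) (d : nat)
  : Prop :=
  (exists f : {mpoly K[n]}, J f /\ f != 0 /\ f \is d.-homog) /\
  (forall (f : {mpoly K[n]}) (e : nat), J f -> f != 0 -> f \is e.-homog -> leq d e).

Definition In_gens (n : nat) : seq Rxyzw :=
  let x : Rxyzw := 'X_(0 : 'I_4) in
  let y : Rxyzw := 'X_(1 : 'I_4) in
  let z : Rxyzw := 'X_(2 : 'I_4) in
  let w : Rxyzw := 'X_(3 : 'I_4) in
  [:: (x ^+ n - y ^+ n) * (z ^+ n - w ^+ n) * x * y;
      (x ^+ n - y ^+ n) * (z ^+ n - w ^+ n) * z * w;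
      (x ^+ n - z ^+ n) * (y ^+ n - w ^+ n) * x * z;
      (x ^+ n - z ^+ n) * (y ^+ n - w ^+ n) * y * w;
      (x ^+ n - w ^+ n) * (y ^+ n - z ^+ n) * x * w;
      (x ^+ n - w ^+ n) * (y ^+ n - z ^+ n) * y * z].

Definition I_n (n : nat) : Rxyzw -> Prop := ideal_of_seq (In_gens n).

(* Main.v *)
(* Write D_ij = X_i^n - X_j^n and A = D_01 D_23, B = D_02 D_13, C = D_03 D_12 = B - A.
   The ideal J = (A, B) is a complete intersection and the intersection of the primes
   of the 4 n^2 lines X_i^n = X_j^n = X_k^n, while I_n is the intersection of J with the
   primes of the six coordinate lines X_i = X_j = 0.  Ideals of lines are handled as
   kernels of substitutions.

   Lower bound: the primes of the 4 n^2 lines are associated to I_n, and I_n is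
   contained in J, so an element of I_n^(m) lies in J^m locally at each of these lines.
   As A, B is a regular sequence and J is radical, it lies in J^m, whose elements
   have only monomials of degree at least 2 n m.

   Upper bound: A^a B^b C^c with a + b + c = m lies in I_n^(m) as soon as
   n a, n b, n c >= m, because A, B, C vanish once along each of the 4 n^2 lines and one
   of them vanishes n times along each coordinate line.  For n >= 5 and m >= 3 one may take
   b = c = floor(m / 3). *)
Require Import Defs.
From Stdlib Require Import Classical_Prop.
From HB Require Import structures.
From mathcomp Require Import all_boot all_algebra mpoly complex Rstruct.
From mathcomp Require Import separable cyclotomic ring zify.

Set Implicit Arguments.
Unset Strict Implicit.
Unset Printing Implicit Defensive.

Import GRing.Theory.
Local Open Scope ring_scope.

(** * Substitutions and linear subspaces *)

Section Substitution.
Variables (K : fieldType) (N : nat).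
Local Notation R := {mpoly K[N]}.
Implicit Types (i j k l : 'I_N) (a b r : K) (h p q : R) (s t : seq K).

(** Restriction to the hyperplane X_i = a X_k, kept as an endomorphism of the same ring, so that
    restrictions compose and their values lie in a domain. *)
Definition msubst i k a : R -> R :=
  fun p => p \mPo [tuple (if l == i then a *: 'X_k else 'X_l) | l < N].

HB.instance Definition _ i k a := GRing.LRMorphism.copy (msubst i k a)
  (comp_mpoly [tuple (if l == i then a *: 'X_k else 'X_l) | l < N]).

Lemma msubstX i k a l : msubst i k a 'X_l = if l == i then a *: 'X_k else 'X_l.
Proof. by rewrite /msubst comp_mpolyXU -tnth_nth tnth_mktuple. Qed.

(** Congruence modulo X_i - a X_k is compatible with sums and products, so it suffices to check it
    on the variables. *)
Lemma msubst_div i k a p : exists q, p = msubst i k a p + ('X_i - a *: 'X_k) * q.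
Proof.
have clM p1 p2 : (exists q, p1 = msubst i k a p1 + ('X_i - a *: 'X_k) * q) ->
    (exists q, p2 = msubst i k a p2 + ('X_i - a *: 'X_k) * q) ->
    exists q, p1 * p2 = msubst i k a (p1 * p2) + ('X_i - a *: 'X_k) * q.
  move=> [q1 E1] [q2 E2]; rewrite rmorphM /=.
  exists (q1 * p2 + msubst i k a p1 * q2).
  by rewrite {1}E1 {1}E2 [in q1 * p2]E2; ring.
have cl1 : exists q, 1 = msubst i k a 1 + ('X_i - a *: 'X_k) * q.
  by exists 0; rewrite rmorph1 mulr0 addr0.
elim/mpolyind: p => [|c m p _ _ [q2 E2]]; first by exists 0; rewrite rmorph0 mulr0 addr0.
have [q1 E1] : exists q, 'X_[m] = msubst i k a 'X_[m] + ('X_i - a *: 'X_k) * q.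
  rewrite mpolyXE_id; elim/big_ind: _ => // l _.
  elim: (m l) => [|e IH]; first by rewrite expr0.
  rewrite exprS; apply: clM => //; rewrite msubstX.
  case: eqP => [->|_]; first by exists 1; rewrite mulr1 addrC subrK.
  by exists 0; rewrite mulr0 addr0.
exists (c *: q1 + q2); rewrite linearD linearZ /= {1}E1 {1}E2.
by rewrite scalerDr mulrDr -scalerAr addrACA.
Qed.

Lemma mulr_vanish i k a p q : msubst i k a p != 0 ->
  msubst i k a (p * q) = 0 -> msubst i k a q = 0.
Proof. by move=> nz /eqP; rewrite rmorphM mulf_eq0 (negPf nz) => /eqP. Qed.

Lemma scaled_var_neq0 a k : a != 0 -> a *: 'X_k != 0 :> R.
Proof.
move=> nz; rewrite -mul_mpolyC mulf_neq0 ?mpolyC_eq0 //.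
by rewrite -msupp_eq0 msuppX.
Qed.

(** The linear factors are split off one at a time: on X_i = r' X_k with r' different from r, the
    factor X_i - r X_k becomes (r' - r) X_k, which is nonzero, so the cofactor still vanishes
    there. *)
Lemma plane_vanish i k s h : i != k -> uniq s ->
  (forall r, r \in s -> msubst i k r h = 0) ->
  exists q, h = \prod_(r <- s) ('X_i - r *: 'X_k) * q.
Proof.
move=> neq; elim: s h => [|r s IH] h /=; first by exists h; rewrite big_nil mul1r.
case/andP=> rs us h0; have [q Eq] := msubst_div i k r h.
rewrite h0 ?mem_head // add0r in Eq.
case: (IH q us) => [r' r's|q' Eq']; last first.
  by exists q'; rewrite big_cons -mulrA -Eq'.
apply: (@mulr_vanish i k r' ('X_i - r *: 'X_k)).
  rewrite linearB linearZ /= !msubstX eqxx [k == i]eq_sym (negPf neq) -scalerBl.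
  by apply: scaled_var_neq0; rewrite subr_eq0; apply: contraNneq rs => <-.
by rewrite -Eq h0 // inE r's orbT.
Qed.

(** One substitution serves both families of lines: roots of unity a, b give a line with X_i^n =
    X_j^n = X_k^n, while a = b = 0 gives the coordinate line X_i = X_j = 0, for which k is only an
    auxiliary index. *)
Definition line_eval i j k a b : R -> R := msubst j k b \o msubst i k a.

HB.instance Definition _ i j k a b :=
  GRing.LRMorphism.copy (line_eval i j k a b) (msubst j k b \o msubst i k a).

Lemma line_evalX i j k a b l : i != k -> j != k -> line_eval i j k a b 'X_l =
  if l == i then a *: 'X_k else if l == j then b *: 'X_k else 'X_l.
Proof.
move=> ik jk; rewrite /line_eval /= msubstX; case: eqP => _; last by rewrite msubstX.
by rewrite linearZ /= msubstX [k == j]eq_sym (negPf jk).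
Qed.

Lemma line_eval_div i j k a b h : exists p q,
  h = line_eval i j k a b h + ('X_i - a *: 'X_k) * p + ('X_j - b *: 'X_k) * q.
Proof.
have [p Ep] := msubst_div i k a h; have [q Eq] := msubst_div j k b (msubst i k a h).
by exists p, q; rewrite {1}Ep {1}Eq addrAC.
Qed.

Lemma line_evalM_eq0 i j k a b p q : line_eval i j k a b p != 0 ->
  line_eval i j k a b (p * q) = 0 -> line_eval i j k a b q = 0.
Proof. by move=> nz /eqP; rewrite rmorphM mulf_eq0 (negPf nz) => /eqP. Qed.

(* Newton interpolation in X_i: peel off the value of h at one node X_i = r X_k,
   which is then handled in the remaining variables. *)
Lemma line_vanish i j k s t h : i != j -> i != k -> j != k -> uniq s -> uniq t ->
  (forall a b, a \in s -> b \in t -> line_eval i j k a b h = 0) ->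
  exists p q, h = p * \prod_(r <- s) ('X_i - r *: 'X_k) +
                  q * \prod_(r <- t) ('X_j - r *: 'X_k).
Proof.
move=> ij ik jk + ut; elim: s h => [|r s IH] h /=.
  by exists h, 0; rewrite big_nil mulr1 mul0r addr0.
case/andP=> rs us h0; have [q Eq] := msubst_div i k r h.
have [q1 Eq1] : exists q1, msubst i k r h = \prod_(r <- t) ('X_j - r *: 'X_k) * q1.
  by apply: plane_vanish => // b bt; apply: (h0 r b); rewrite ?mem_head.
case: (IH q us) => [a b as_ bt|p2 [q2 E2]]; last first.
  exists p2, (q1 + ('X_i - r *: 'X_k) * q2).
  by rewrite Eq Eq1 E2 big_cons; ring.
apply: (@line_evalM_eq0 i j k a b ('X_i - r *: 'X_k)).
  rewrite linearB linearZ /= !line_evalX // eqxx [k == i]eq_sym [k == j]eq_sym.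
  rewrite (negPf ik) (negPf jk) -scalerBl; apply: scaled_var_neq0; rewrite subr_eq0.
  by apply: contraNneq rs => <-.
have -> : ('X_i - r *: 'X_k) * q = h - msubst i k r h.
  by rewrite {1}Eq [msubst _ _ _ _ + _]addrC addrK.
(* The subtracted value is a multiple of the product over [t], hence it also vanishes where X_j = b
   X_k. *)
rewrite rmorphB /= h0 ?inE ?as_ ?orbT // Eq1 rmorphM rmorph_prod /=.
rewrite (big_rem b) //= linearB linearZ /= !line_evalX // eqxx.
rewrite [k == i]eq_sym [k == j]eq_sym (negPf ik) (negPf jk) [j == i]eq_sym (negPf ij).
by rewrite subrr !mul0r subr0.
Qed.

End Substitution.

(** * Factorization of X_i^n - X_k^n into linear forms *)

Lemma homogenize_prod (F : fieldType) (s : seq F) (x y : F) : y != 0 ->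
  y ^+ size s * \prod_(r <- s) (x / y - r) = \prod_(r <- s) (x - r * y).
Proof.
move=> nz; elim: s => [|r s IH]; first by rewrite !big_nil mulr1.
by rewrite !big_cons -IH exprS; field.
Qed.

(** As n is invertible, the one-variable polynomial X^n - 1 is separable and splits into distinct
    factors. Evaluating this factorization at X_i / X_k in the fraction field and clearing
    denominators gives the homogeneous one. *)
Lemma roots_of_unity (K : closedFieldType) (n : nat) : n%:R != 0 :> K ->
  exists s : seq K, [/\ uniq s, forall r, (r \in s) = (r ^+ n == 1) &
   forall N (i k : 'I_N),
    'X_i ^+ n - 'X_k ^+ n = \prod_(r <- s) ('X_i - r *: 'X_k) :> {mpoly K[N]}].
Proof.
move=> nz; have n_gt0 : (0 < n)%N by case: n nz; rewrite ?eqxx.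
have [s] := closed_field_poly_normal ('X^n - 1 : {poly K}).
rewrite (monicP _) ?scale1r; last by rewrite -polyC1 monicXnsubC.
move=> Es; exists s; split=> [|r|N i k].
- by rewrite -separable_prod_XsubC -Es separable_Xn_sub_1.
- by rewrite -root_prod_XsubC -Es rootE !hornerE subr_eq0.
pose F := {fraction {mpoly K[N]}}; pose X l : F := tofrac ('X_l : {mpoly K[N]}).
pose c : K -> F := @tofrac {mpoly K[N]} \o @mpolyC N K.
have szs : size s = n.
  by apply: succn_inj; rewrite -(size_prod_XsubC s id) -Es -polyC1 size_XnsubC.
have Xk : X k != 0 by rewrite tofrac_eq0 -msupp_eq0 msuppX.
have ev : (X i / X k) ^+ n - 1 = \prod_(r <- s) (X i / X k - c r).
  have /(congr1 (fun p => (map_poly c p).[X i / X k])) := Es.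
  rewrite rmorphB rmorph1 /= map_polyXn rmorph_prod !hornerE horner_prod => ->.
  by apply: eq_bigr => r _; rewrite rmorphB /= map_polyX map_polyC !hornerE.
have scaled r : tofrac ('X_i - r *: 'X_k : {mpoly K[N]}) = X i - c r * X k.
  by rewrite rmorphB /= -mul_mpolyC rmorphM.
apply/eqP; rewrite -tofrac_eq rmorph_prod /= (eq_bigr _ (fun r _ => scaled r)).
rewrite rmorphB !rmorphXn /= -/(X i) -/(X k).
have := homogenize_prod (map c s) (X i) Xk.
rewrite size_map szs !big_map -ev => <-.
by rewrite mulrBr mulr1 -exprMn mulrC divfK.
Qed.

(** * Powers of ideals *)

Section IdealPowers.
Variable A : comNzRingType.
Implicit Types (S I J : A -> Prop) (f g : A).

Lemma ideal_gen_mem S g : S g -> ideal_gen S g.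
Proof.
by move=> Sg; exists 1%N, (fun=> 1), (fun=> g); rewrite big_ord1 mul1r.
Qed.

Lemma ideal_gen_is_ideal S : is_ideal (ideal_gen S).
Proof.
split; first by exists 0%N, (fun=> 0), (fun=> 0); split; [case | rewrite big_ord0].
split=> [a b [k1 [c1 [g1 [S1 ->]]]] [k2 [c2 [g2 [S2 ->]]]]|r a [k [c [g [Sg ->]]]]].
  exists (k1 + k2)%N, (fun i => match split i with inl j => c1 j | inr j => c2 j end),
    (fun i => match split i with inl j => g1 j | inr j => g2 j end).
  split=> [i|]; first by case: (split i).
  rewrite big_split_ord; congr (_ + _); apply: eq_bigr => i _.
    by rewrite (unsplitK (inl i)).
  by rewrite (unsplitK (inr i)).
exists k, (fun i => r * c i), g; split=> //.
by rewrite mulr_sumr; apply: eq_bigr => i _; rewrite mulrA.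
Qed.

Lemma ideal_sum J k (F : 'I_k -> A) : is_ideal J -> (forall i, J (F i)) ->
  J (\sum_i F i).
Proof. by case=> J0 [JD _] JF; elim/big_ind: _. Qed.

Lemma ideal_gen_min S J : is_ideal J -> (forall g, S g -> J g) ->
  forall g, ideal_gen S g -> J g.
Proof.
move=> idJ SJ _ [k [c [g [Sg ->]]]]; apply: ideal_sum => // i.
by case: idJ => _ [_ JM]; apply/JM/SJ.
Qed.

Lemma ideal_of_seq6 g1 g2 g3 g4 g5 g6 h :
  ideal_of_seq [:: g1; g2; g3; g4; g5; g6] h <-> exists c1 c2 c3 c4 c5 c6,
  h = c1 * g1 + c2 * g2 + c3 * g3 + c4 * g4 + c5 * g5 + c6 * g6.
Proof.
have [_ [ID IM]] := ideal_gen_is_ideal (fun g => g \in [:: g1; g2; g3; g4; g5; g6]).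
split; last first.
  move=> [c1 [c2 [c3 [c4 [c5 [c6 ->]]]]]].
  by do 5?apply: (ID); apply: (IM); apply: ideal_gen_mem; rewrite !inE eqxx ?orbT.
rewrite /ideal_of_seq; move: h; apply: ideal_gen_min.
  split; first by exists 0, 0, 0, 0, 0, 0; rewrite !mul0r !addr0.
  split=> [_ _ [c1 [c2 [c3 [c4 [c5 [c6 ->]]]]]] [d1 [d2 [d3 [d4 [d5 [d6 ->]]]]]]|].
    by exists (c1 + d1), (c2 + d2), (c3 + d3), (c4 + d4), (c5 + d5), (c6 + d6); ring.
  move=> r _ [c1 [c2 [c3 [c4 [c5 [c6 ->]]]]]].
  by exists (r * c1), (r * c2), (r * c3), (r * c4), (r * c5), (r * c6); ring.
move=> g; rewrite !inE.
case/orP=> [/eqP->|]; first by exists 1, 0, 0, 0, 0, 0; ring.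
case/orP=> [/eqP->|]; first by exists 0, 1, 0, 0, 0, 0; ring.
case/orP=> [/eqP->|]; first by exists 0, 0, 1, 0, 0, 0; ring.
case/orP=> [/eqP->|]; first by exists 0, 0, 0, 1, 0, 0; ring.
case/orP=> [/eqP->|/eqP->]; first by exists 0, 0, 0, 0, 1, 0; ring.
by exists 0, 0, 0, 0, 0, 1; ring.
Qed.

Lemma ideal_pow_is_ideal I m : is_ideal (ideal_pow I m).
Proof. by case: m => [|m]; last exact: ideal_gen_is_ideal. Qed.

Lemma ideal_powMl I m f g : ideal_pow I m g -> ideal_pow I m (f * g).
Proof. by case: (ideal_pow_is_ideal I m) => _ [_]; apply. Qed.

Lemma ideal_powM I a b f g :
  ideal_pow I a f -> ideal_pow I b g -> ideal_pow I (a + b) (f * g).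
Proof.
move=> If; elim: b g => [|b IH] g /=.
  by rewrite addn0 => _; rewrite mulrC; apply: ideal_powMl.
rewrite addnS; move: g; apply: ideal_gen_min => [|g [u [v [Iu [Iv ->]]]]].
  have [I0 [ID IM]] := ideal_pow_is_ideal I (a + b).+1.
  split; first by rewrite mulr0.
  by split=> [u v Iu Iv|r u Iu]; rewrite ?mulrDr ?(mulrCA f); [apply: ID | apply: IM].
by rewrite mulrA; apply: ideal_gen_mem; exists (f * u), v; split; first exact: IH.
Qed.

Lemma ideal_powX I a k f : ideal_pow I a f -> ideal_pow I (a * k) (f ^+ k).
Proof.
move=> If; elim: k => [|k IH]; first by rewrite muln0.
by rewrite exprS mulnS; apply: ideal_powM.
Qed.

Lemma ideal_pow1 I f : I f -> ideal_pow I 1 f.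
Proof. by move=> If; apply: ideal_gen_mem; exists 1, f; rewrite mul1r. Qed.

Lemma ideal_powXn I k f : I f -> ideal_pow I k (f ^+ k).
Proof. by move/ideal_pow1/(ideal_powX k); rewrite mul1n. Qed.

Lemma ideal_pow_le I a b f : (a <= b)%N -> ideal_pow I b f -> ideal_pow I a f.
Proof.
elim: b f => [|b IH] f; first by rewrite leqn0 => /eqP->.
rewrite leq_eqVlt ltnS => /predU1P[->//|ab] Ibf; apply: IH => //; move: f Ibf.
apply: ideal_gen_min => [|f [u [v [Iu [_ ->]]]]]; first exact: ideal_pow_is_ideal.
by rewrite mulrC; apply: ideal_powMl.
Qed.

(** The product equals ((x t)^n - (y t)^n)^a, which lies in I^(n a). This converts n-fold vanishing
    along x = y = 0 into membership in I^m, up to the multiplier t^(n a). *)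
Lemma ideal_pow_subXX I n a m x y t : (m <= n * a)%N -> I (x * t) -> I (y * t) ->
  ideal_pow I m (t ^+ (n * a) * (x ^+ n - y ^+ n) ^+ a).
Proof.
move=> le Ix Iy; apply: (ideal_pow_le le); rewrite exprM -exprMn.
apply: ideal_powX; rewrite mulrBr -!exprMn ![t * _]mulrC.
have [_ [ID IM]] := ideal_pow_is_ideal I n.
by apply: ID; [|rewrite -mulN1r; apply: IM]; apply: ideal_powXn.
Qed.

(* pow2 a b k is (a, b)^k, described by (a, b)^(k+1) = a (a, b)^k + (b^(k+1)). *)
Fixpoint pow2 (a b : A) (k : nat) : A -> Prop :=
  match k with
  | 0%N => fun=> True
  | k'.+1 => fun f => exists u c, pow2 a b k' u /\ f = a * u + c * b ^+ k'.+1
  end.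

Lemma pow2_is_ideal a b k : is_ideal (pow2 a b k).
Proof.
elim: k => [//|k [P0 [PD PM]]]; split.
  by exists 0, 0; rewrite mulr0 mul0r addr0.
split=> [_ _ [u [c [Pu ->]]] [v [d [Pv ->]]]|r _ [u [c [Pu ->]]]].
  by exists (u + v), (c + d); split; [exact: PD | ring].
by exists (r * u), (r * c); split; [exact: PM | ring].
Qed.

Lemma pow2S_sub a b k f : pow2 a b k.+1 f -> pow2 a b k f.
Proof.
elim: k f => [//|k IH] f [u [c [Pu ->]]].
by exists u, (c * b); split; [exact: IH | rewrite -mulrA -exprS].
Qed.

Lemma pow2_bM a b k f : pow2 a b k f -> pow2 a b k.+1 (b * f).
Proof.
elim: k f => [|k IH] f.
  by exists 0, f; rewrite mulr0 add0r expr1 mulrC.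
move=> [u [c [Pu ->]]]; exists (b * u), c; split; first exact: IH.
by rewrite [b ^+ k.+2]exprS; ring.
Qed.

Lemma pow2_mul a b k f p q : pow2 a b k f -> pow2 a b k.+1 (f * (p * a + q * b)).
Proof.
move=> Pf; have [_ [PD PM]] := pow2_is_ideal a b k.+1.
have -> : f * (p * a + q * b) = p * (a * f) + q * (b * f) by ring.
apply: PD; apply: PM; last exact: pow2_bM.
by exists f, 0; rewrite mul0r addr0.
Qed.

Lemma ideal_pow_pow2 I a b k f : (forall g, I g -> exists p q, g = p * a + q * b) ->
  ideal_pow I k f -> pow2 a b k f.
Proof.
move=> IJ; elim: k f => [//|k IH]; apply: ideal_gen_min => [|_ [u [v [Iu [Iv ->]]]]].
  exact: pow2_is_ideal.
by have [p [q ->]] := IJ v Iv; apply: pow2_mul; apply: IH.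
Qed.

(* A regular sequence (a, b) is quasi-regular: if f is in (a, b)^k and s f is in
   (a, b)^(k+1), then s times any coefficient of f is in (a, b).  With s outside P the
   coefficient is in P, and being in every P of L it is in (a, b). *)
Lemma pow2_saturated (L : (A -> Prop) -> Prop) a b k f : GRing.lreg a ->
  (forall P, L P -> is_prime_ideal P) ->
  (forall h, (forall P, L P -> P h) <-> exists p q, h = p * a + q * b) ->
  (forall e p q, a * p = b ^+ e * q -> exists q', q = a * q') ->
  (forall P, L P -> exists2 s, ~ P s & pow2 a b k (s * f)) -> pow2 a b k f.
Proof.
move=> rega prP radP regb.
have inP P s h : L P -> ~ P s -> P (s * h) -> P h.
  by move=> LP Ps Psh; case: (prP P LP) => _ [_ /(_ _ _ Psh)] [].
elim: k f => [//|k IHk] f sf; have {IHk}: pow2 a b k f.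
  by apply: IHk => P LP; have [s Ps /pow2S_sub] := sf P LP; exists s.
(* The inner induction shows that an f in (a, b)^k which is locally in (a, b)^(k+1) is in (a,
   b)^(k+1). *)
elim: k f sf => [|k IH] f sf.
  move=> _; have /radP[p [q ->]] : forall P, L P -> P f.
    move=> P LP; have [s Ps [u [c [_ E]]]] := sf P LP; apply: (inP P s) => //.
    by move: P LP {Ps}; apply/radP; exists u, c; rewrite E expr1 mulrC.
  by exists p, q; rewrite expr1 mulrC.
move=> [u [c [Pu Ef]]].
(* Two expansions of s f are compared: s (a u + c b^(k+1)) and a v + d b^(k+2). By regularity a then
   divides d b - s c, which puts s c in (a, b). *)
have key P : L P -> exists2 s, ~ P s & exists v d,
    [/\ pow2 a b k.+1 v & a * (s * u - v) = b ^+ k.+1 * (d * b - s * c)].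
  move=> LP; have [s Ps [v [d [Pv E]]]] := sf P LP; exists s => //; exists v, d; split=> //.
  apply/eqP; rewrite -subr_eq0; apply/eqP.
  transitivity (s * f - (a * v + d * b ^+ k.+2)); last by rewrite E subrr.
  by rewrite Ef [b ^+ k.+2]exprS; ring.
have /radP[c1 [c2 Ec]] : forall P, L P -> P c.
  move=> P LP; have [s Ps [w [d [_ /regb[e Ee]]]]] := key P LP.
  apply: (inP P s) => //; move: P LP {Ps}; apply/radP; exists (- e), d.
  by rewrite mulNr [e * a]mulrC -Ee; ring.
have [_ [PD PM]] := pow2_is_ideal a b k.
(* With c = c1 a + c2 b, the part c1 a b^(k+1) of f moves into the cofactor of a. The induction
   hypothesis is applied to this new cofactor. *)
exists (u + c1 * b ^+ k.+1), c2; split; last first.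
  by rewrite Ef Ec [b ^+ k.+2]exprS; ring.
have Pu' : pow2 a b k (u + c1 * b ^+ k.+1).
  apply: PD => //; apply: PM; case: (k) => // k'.
  by exists 0, b; rewrite exprS; split; [case: (pow2_is_ideal a b k') | ring].
apply: IH => // P LP; have [s Ps [v [d [Pv E]]]] := key P LP; exists s => //.
have E' : a * (s * (u + c1 * b ^+ k.+1) - v) = b ^+ k.+2 * (d - s * c2).
  have -> : a * (s * (u + c1 * b ^+ k.+1) - v) =
    a * (s * u - v) + s * c1 * a * b ^+ k.+1 by ring.
  by rewrite E Ec [b ^+ k.+2]exprS; ring.
have [e Ee] := regb _ _ _ E'.
(* Cancelling a in [E'] leaves two terms that both lie in (a, b)^(k+1). *)
have -> : s * (u + c1 * b ^+ k.+1) = v + b * e * b ^+ k.+1.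
  apply/eqP; rewrite -subr_eq0; apply/eqP/rega.
  have -> : s * (u + c1 * b ^+ k.+1) - (v + b * e * b ^+ k.+1) =
    (s * (u + c1 * b ^+ k.+1) - v) - b * e * b ^+ k.+1 by ring.
  by rewrite mulrBr E' Ee [b ^+ k.+2]exprS mulr0; ring.
have [_ [PD' PM']] := pow2_is_ideal a b k.+1; apply: PD' => //.
by exists 0, (b * e); split; [case: (pow2_is_ideal a b k) | rewrite mulr0 add0r].
Qed.

End IdealPowers.

(** * The Fermat configuration of lines *)

Section FermatLines.
Variables (K : fieldType) (N n : nat) (s : seq K).
Local Notation R := {mpoly K[N]}.
Local Notation D i j := ('X_i ^+ n - 'X_j ^+ n : R).
Implicit Types (i j k l : 'I_N) (r a b : K) (h : R).
Hypothesis n_gt0 : (0 < n)%N.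
Hypothesis s_uniq : uniq s.
Hypothesis s_root : forall r, (r \in s) = (r ^+ n == 1).
Hypothesis Dprod : forall i k, D i k = \prod_(r <- s) ('X_i - r *: 'X_k).

Lemma line_evalM_neq0 i j k a b (f g : R) : line_eval i j k a b f != 0 ->
  line_eval i j k a b g != 0 -> line_eval i j k a b (f * g) != 0.
Proof. by rewrite rmorphM /=; apply: mulf_neq0. Qed.

Lemma line_eval_subM i j k a b (f g c : R) : line_eval i j k a b f = 0 ->
  line_eval i j k a b g = 0 -> line_eval i j k a b (f - c * g) = 0.
Proof. by move=> f0 g0; rewrite rmorphB rmorphM /= f0 g0 mulr0 subr0. Qed.

Lemma mpolyX_neq0 (i : 'I_N) : 'X_i != 0 :> R.
Proof. by rewrite -msupp_eq0 msuppX. Qed.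

Lemma mpolyXn_neq0 (i : 'I_N) : 'X_i ^+ n != 0 :> R.
Proof. by rewrite expf_neq0 ?mpolyX_neq0. Qed.

Lemma fermat_neq0 i j : i != j -> D i j != 0.
Proof.
move=> ij; apply/eqP => /(congr1 (msubst i j 0)).
rewrite rmorph0 rmorphB !rmorphXn /= !msubstX eqxx [j == i]eq_sym (negPf ij).
rewrite scale0r expr0n gtn_eqF // sub0r; apply/eqP.
by rewrite oppr_eq0 mpolyXn_neq0.
Qed.

Lemma root_neq0 r : r \in s -> r != 0.
Proof.
by rewrite s_root; apply: contraTneq => ->; rewrite expr0n gtn_eqF // eq_sym oner_eq0.
Qed.

Lemma root_scaleX r i : r \in s -> (r *: 'X_i) ^+ n = 'X_i ^+ n :> R.
Proof. by rewrite s_root exprZn => /eqP->; rewrite scale1r. Qed.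

Lemma msubst_Xn i k r : r \in s -> msubst i k r ('X_i ^+ n) = 'X_k ^+ n.
Proof. by move=> rs; rewrite rmorphXn /= msubstX eqxx root_scaleX. Qed.

Lemma msubst_Xn0 i k r (p : 'I_N) : p != i -> msubst i k r ('X_p ^+ n) = 'X_p ^+ n.
Proof. by move=> pi; rewrite rmorphXn /= msubstX (negPf pi). Qed.

Lemma fermat_plane_vanish i k h : i != k ->
  (forall r, r \in s -> msubst i k r h = 0) -> exists q, h = D i k * q.
Proof. by move=> ik h0; rewrite Dprod; apply: plane_vanish. Qed.

Lemma line_X0_neq0 i j k a b (p : 'I_N) : i != k -> j != k -> p != i -> p != j ->
  line_eval i j k a b 'X_p != 0.
Proof.
by move=> ik jk pi pj; rewrite line_evalX // (negPf pi) (negPf pj) mpolyX_neq0.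
Qed.

Lemma coord_X1 i j k : i != k -> j != k -> line_eval i j k (0 : K) 0 'X_i = 0.
Proof. by move=> ik jk; rewrite line_evalX // eqxx scale0r. Qed.

Lemma coord_X2 i j k : i != k -> j != k -> line_eval i j k (0 : K) 0 'X_j = 0.
Proof. by move=> ik jk; rewrite line_evalX // eqxx; case: (j == i); rewrite scale0r. Qed.

(** * Restrictions of the forms X_p^n - X_q^n to coordinate lines and Fermat lines *)

Section LineImages.
Variables (i j k : 'I_N).
Hypotheses (ik : i != k) (jk : j != k).

Lemma line_Xn0 a b (p : 'I_N) : p != i -> p != j ->
  line_eval i j k a b ('X_p ^+ n) = 'X_p ^+ n.
Proof. by move=> pi pj; rewrite rmorphXn /= line_evalX // (negPf pi) (negPf pj). Qed.

Lemma coord_Xn1 : line_eval i j k (0 : K) 0 ('X_i ^+ n) = 0.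
Proof. by rewrite rmorphXn /= line_evalX // eqxx scale0r expr0n gtn_eqF. Qed.

Lemma coord_Xn2 : line_eval i j k (0 : K) 0 ('X_j ^+ n) = 0.
Proof.
rewrite rmorphXn /= line_evalX // eqxx.
by case: (j == i); rewrite scale0r expr0n gtn_eqF.
Qed.

Lemma coord_fermat12 : line_eval i j k (0 : K) 0 (D i j) = 0.
Proof. by rewrite rmorphB /= coord_Xn1 coord_Xn2 subrr. Qed.

Lemma coord_fermat1_neq0 (p : 'I_N) : p != i -> p != j ->
  line_eval i j k (0 : K) 0 (D i p) != 0.
Proof.
by move=> pi pj; rewrite rmorphB /= coord_Xn1 line_Xn0 // sub0r oppr_eq0 mpolyXn_neq0.
Qed.

Lemma coord_fermat2_neq0 (p : 'I_N) : p != i -> p != j ->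
  line_eval i j k (0 : K) 0 (D j p) != 0.
Proof.
by move=> pi pj; rewrite rmorphB /= coord_Xn2 line_Xn0 // sub0r oppr_eq0 mpolyXn_neq0.
Qed.

Lemma coord_fermat1r_neq0 (p : 'I_N) : p != i -> p != j ->
  line_eval i j k (0 : K) 0 (D p i) != 0.
Proof. by move=> pi pj; rewrite rmorphB /= coord_Xn1 line_Xn0 // subr0 mpolyXn_neq0. Qed.

Lemma coord_fermat2r_neq0 (p : 'I_N) : p != i -> p != j ->
  line_eval i j k (0 : K) 0 (D p j) != 0.
Proof. by move=> pi pj; rewrite rmorphB /= coord_Xn2 line_Xn0 // subr0 mpolyXn_neq0. Qed.

Variables (a b : K).
Hypotheses (sa : a \in s) (sb : b \in s).
Local Notation phi := (line_eval i j k a b).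

Lemma line_Xn1 : phi ('X_i ^+ n) = 'X_k ^+ n.
Proof. by rewrite rmorphXn /= line_evalX // eqxx root_scaleX. Qed.

Lemma line_Xn2 : phi ('X_j ^+ n) = 'X_k ^+ n.
Proof.
rewrite rmorphXn /= line_evalX // eqxx.
by case: (j == i); rewrite root_scaleX.
Qed.

Lemma line_Xn3 : phi ('X_k ^+ n) = 'X_k ^+ n.
Proof. by apply: line_Xn0; rewrite eq_sym. Qed.

Lemma line_fermat12 : phi (D i j) = 0.
Proof. by rewrite rmorphB /= line_Xn1 line_Xn2 subrr. Qed.

Lemma line_fermat13 : phi (D i k) = 0.
Proof. by rewrite rmorphB /= line_Xn1 line_Xn3 subrr. Qed.

Lemma line_fermat23 : phi (D j k) = 0.
Proof. by rewrite rmorphB /= line_Xn2 line_Xn3 subrr. Qed.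

Variable l : 'I_N.
Hypotheses (li : l != i) (lj : l != j) (lk : l != k).

Lemma line_fermat14 : phi (D i l) != 0.
Proof. by rewrite rmorphB /= line_Xn1 line_Xn0 // fermat_neq0 // eq_sym. Qed.

Lemma line_fermat24 : phi (D j l) != 0.
Proof. by rewrite rmorphB /= line_Xn2 line_Xn0 // fermat_neq0 // eq_sym. Qed.

Lemma line_fermat43 : phi (D l k) != 0.
Proof. by rewrite rmorphB /= line_Xn3 line_Xn0 // fermat_neq0. Qed.

End LineImages.

(** * Forms vanishing on the Fermat lines and on the coordinate lines *)

Definition vanish_triple i j k (h : R) :=
  forall a b, a \in s -> b \in s -> line_eval i j k a b h = 0.

Lemma vanish_tripleP i j k h : i != j -> i != k -> j != k ->
  vanish_triple i j k h -> exists p q, h = p * D i k + q * D j k.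
Proof. by move=> ij ik jk h0; rewrite !Dprod; apply: line_vanish. Qed.

Lemma vanish_tripleM i j k p q :
  (forall a b, a \in s -> b \in s -> line_eval i j k a b p != 0) ->
  vanish_triple i j k (p * q) -> vanish_triple i j k q.
Proof.
move=> nz pq0 a b sa sb.
by apply: (@line_evalM_eq0 _ _ i j k a b p); [apply: nz | apply: pq0].
Qed.

(** Vanishing on the two opposite lines X_i = X_j = 0 and X_k = X_l = 0; the third index of each
    [line_eval] is a dummy, being scaled by 0. *)
Definition vanish_coord i j k l (h : R) := line_eval i j k 0 0 h = 0 /\
  line_eval k l i 0 0 h = 0.

(** Dividing h by X_i, X_j and then the cofactors by X_k, X_l leaves a remainder X_i p0 + X_j q0,
    which is the restriction of h to X_k = X_l = 0 and so vanishes. *)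
Lemma vanish_coordP i j k l h : uniq [:: i; j; k; l] -> vanish_coord i j k l h ->
  exists c1 c2 c3 c4, h = c1 * ('X_i * 'X_k) + c2 * ('X_i * 'X_l) +
                          c3 * ('X_j * 'X_k) + c4 * ('X_j * 'X_l).
Proof.
rewrite /= !inE !negb_or => /and4P[/and3P[ij ik il] /andP[jk jl] kl _] [hij hkl].
have [p [q Eh]] := line_eval_div i j k 0 0 h.
have [p1 [p2 Ep]] := line_eval_div k l i 0 0 p.
have [q1 [q2 Eq]] := line_eval_div k l i 0 0 q.
rewrite hij add0r !scale0r !subr0 in Eh; rewrite !scale0r !subr0 in Ep Eq.
exists p1, p2, q1, q2; have : line_eval k l i 0 0 h = 0 by [].
have [ki li] : k != i /\ l != i by rewrite ![_ == i]eq_sym.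
rewrite {1}Eh rmorphD !rmorphM /= !line_evalX //.
rewrite (negPf ik) (negPf il) (negPf jk) (negPf jl).
move: (line_eval k l i 0 0 p) (line_eval k l i 0 0 q) Ep Eq => p0 q0 Ep Eq E0.
transitivity (h - ('X_i * p0 + 'X_j * q0)); first by rewrite E0 subr0.
by rewrite Eh Ep Eq; ring.
Qed.

Section FourVariables.
Variables i j k l : 'I_N.
Hypotheses (ij : i != j) (ik : i != k) (il : i != l).
Hypotheses (jk : j != k) (jl : j != l) (kl : k != l).
Local Notation A := (D i j * D k l).
Local Notation B := (D i k * D j l).
Local Notation C := (D i l * D j k).

Let ji : j != i. Proof. by rewrite eq_sym. Qed.
Let ki : k != i. Proof. by rewrite eq_sym. Qed.
Let li : l != i. Proof. by rewrite eq_sym. Qed.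
Let kj : k != j. Proof. by rewrite eq_sym. Qed.
Let lj : l != j. Proof. by rewrite eq_sym. Qed.
Let lk : l != k. Proof. by rewrite eq_sym. Qed.

(** The triples are imposed one after another. On each new triple the terms already known to vanish
    drop out and the factor in front of the remaining cofactor does not vanish, so [vanish_tripleP]
    expands that cofactor. *)
Lemma four_triples_vanish h :
  vanish_triple i j l h -> vanish_triple i k l h -> vanish_triple j k l h ->
  vanish_triple i j k h -> exists p q, h = p * A + q * B.
Proof.
move=> hijl hikl hjkl hijk.
have [al [be Eh]] := vanish_tripleP ij il jl hijl.
have [b1 [b2 Eb]] : exists p q, be = p * D i l + q * D k l.
  apply: (vanish_tripleP ik il kl).
  apply: (@vanish_tripleM _ _ _ (D j l)) => a b sa sb; first exact: line_fermat43.
  have -> : D j l * be = h - al * D i l by rewrite Eh; ring.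
  by apply: line_eval_subM; [exact: hikl | exact: line_fermat13].
pose al' := al + b1 * D j l.
have {}Eh : h = al' * D i l + b2 * (D j l * D k l).
  by rewrite Eh Eb /al'; ring.
have [a1 [a2 Ea]] : exists p q, al' = p * D j l + q * D k l.
  apply: (vanish_tripleP jk jl kl).
  apply: (@vanish_tripleM _ _ _ (D i l)) => a b sa sb; first exact: line_fermat43.
  have -> : D i l * al' = h - b2 * D j l * D k l by rewrite Eh; ring.
  by apply: line_eval_subM; [exact: hjkl | exact: line_fermat23].
(* Modulo A and B the products D_il D_jl, D_il D_kl and D_jl D_kl coincide, so only the sum of their
   coefficients matters. *)
pose e := a1 + a2 + b2.
have {}Eh : h = e * (D i l * D j l) + a2 * (A - B) - b2 * B.
  by rewrite Eh Ea /e; ring.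
have [e1 [e2 Ee]] : exists p q, e = p * D i k + q * D j k.
  apply: (vanish_tripleP ij ik jk).
  apply: (@vanish_tripleM _ _ _ (D i l * D j l)) => a b sa sb.
    by apply: line_evalM_neq0; [exact: line_fermat14 | exact: line_fermat24].
  have -> : D i l * D j l * e = h - a2 * D k l * D i j - (- (a2 + b2) * D j l) * D i k.
    by rewrite Eh; ring.
  apply: line_eval_subM; last exact: line_fermat13.
  by apply: line_eval_subM; [exact: hijk | exact: line_fermat12].
(* Here D_il D_jl D_ik = D_il B and D_il D_jl D_jk = D_jl C = D_jl (B - A). *)
exists (a2 - e2 * D j l), (e1 * D i l + e2 * D j l - a2 - b2).
by rewrite Eh Ee; ring.
Qed.

Lemma fermat_BA : B - A = C.
Proof. ring. Qed.

(* On X_i = X_l = 0 the forms A and B agree, so vanishing there constrains only the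
   sum of the two coefficients. *)
Lemma fermat_lines_vanish h : (exists p q, h = p * A + q * B) ->
  vanish_coord i j k l h -> vanish_coord i k j l h -> vanish_coord i l j k h ->
  exists c1 c2 c3 c4 c5 c6,
  h = c1 * (A * 'X_i * 'X_j) + c2 * (A * 'X_k * 'X_l) +
      c3 * (B * 'X_i * 'X_k) + c4 * (B * 'X_j * 'X_l) +
      c5 * (C * 'X_i * 'X_l) + c6 * (C * 'X_j * 'X_k).
Proof.
move=> [al [be Eh]] [hij hkl] [hik hjl] [hil hjk].
have uij : uniq [:: i; j; k; l] by rewrite /= !inE !negb_or ij ik il jk jl kl.
have uik : uniq [:: i; k; j; l] by rewrite /= !inE !negb_or ij ik il kj jl kl.
(* On X_i = X_j = 0 and on X_k = X_l = 0 the form A vanishes and B does not, so the coefficient of B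
   vanishes there. The pairs i, k and j, l do the same for the coefficient of A. *)
have [|b1 [b2 [b3 [b4 Eb]]]] := vanish_coordP uij (h := be).
  split.
    apply: (@line_evalM_eq0 _ _ i j k 0 0 B).
      by apply: line_evalM_neq0; [exact: coord_fermat1_neq0 | exact: coord_fermat2_neq0].
    have -> : B * be = h - al * D k l * D i j by rewrite Eh; ring.
    by apply: line_eval_subM; [exact: hij | exact: coord_fermat12].
  apply: (@line_evalM_eq0 _ _ k l i 0 0 B).
    by apply: line_evalM_neq0; [exact: coord_fermat1r_neq0 | exact: coord_fermat2r_neq0].
  have -> : B * be = h - al * D i j * D k l by rewrite Eh; ring.
  by apply: line_eval_subM; [exact: hkl | exact: coord_fermat12].
have [|a1 [a2 [a3 [a4 Ea]]]] := vanish_coordP uik (h := al).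
  split.
    apply: (@line_evalM_eq0 _ _ i k j 0 0 A).
      by apply: line_evalM_neq0; [exact: coord_fermat1_neq0 | exact: coord_fermat2_neq0].
    have -> : A * al = h - be * D j l * D i k by rewrite Eh; ring.
    by apply: line_eval_subM; [exact: hik | exact: coord_fermat12].
  apply: (@line_evalM_eq0 _ _ j l i 0 0 A).
    by apply: line_evalM_neq0; [exact: coord_fermat1r_neq0 | exact: coord_fermat2r_neq0].
  have -> : A * al = h - be * D i k * D j l by rewrite Eh; ring.
  by apply: line_eval_subM; [exact: hjl | exact: coord_fermat12].
(* The terms in A X_j X_k and A X_i X_l are rewritten by A = B - C: the C parts are multiples of
   generators, and the B parts are collected in u and v. *)
pose u := a3 + b3; pose v := a2 + b2.
have {}Eh : h = a1 * (A * 'X_i * 'X_j) + a4 * (A * 'X_k * 'X_l) +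
   b1 * (B * 'X_i * 'X_k) + b4 * (B * 'X_j * 'X_l) -
   a2 * (C * 'X_i * 'X_l) - a3 * (C * 'X_j * 'X_k) +
   u * (B * 'X_j * 'X_k) + v * (B * 'X_i * 'X_l).
  by rewrite Eh Ea Eb /u /v -fermat_BA; ring.
have [e1 [e2 Eu]] : exists e1 e2, u = 'X_i * e1 + 'X_l * e2.
  have [e1 [e2 Eu]] := line_eval_div i l j 0 0 u; exists e1, e2.
  rewrite Eu !scale0r !subr0; suff -> : line_eval i l j 0 0 u = 0 by rewrite add0r.
  apply: (@line_evalM_eq0 _ _ i l j 0 0 (B * ('X_j * 'X_k))).
    apply: line_evalM_neq0.
      by apply: line_evalM_neq0; [exact: coord_fermat1_neq0 | exact: coord_fermat2r_neq0].
    by apply: line_evalM_neq0; exact: line_X0_neq0.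
  have -> : B * ('X_j * 'X_k) * u = h -
      (a1 * A * 'X_j + b1 * B * 'X_k - a2 * C * 'X_l + v * B * 'X_l) * 'X_i -
      (a4 * A * 'X_k + b4 * B * 'X_j) * 'X_l - (- a3 * D j k * 'X_j * 'X_k) * D i l.
    by rewrite Eh; ring.
  apply: line_eval_subM; last exact: coord_fermat12.
  apply: line_eval_subM; last exact: coord_X2.
  by apply: line_eval_subM; [exact: hil | exact: coord_X1].
have [e3 [e4 Ev]] : exists e3 e4, v = 'X_j * e3 + 'X_k * e4.
  have [e3 [e4 Ev]] := line_eval_div j k i 0 0 v; exists e3, e4.
  rewrite Ev !scale0r !subr0; suff -> : line_eval j k i 0 0 v = 0 by rewrite add0r.
  apply: (@line_evalM_eq0 _ _ j k i 0 0 (B * ('X_i * 'X_l))).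
    apply: line_evalM_neq0.
      by apply: line_evalM_neq0; [exact: coord_fermat2r_neq0 | exact: coord_fermat1_neq0].
    by apply: line_evalM_neq0; exact: line_X0_neq0.
  have -> : B * ('X_i * 'X_l) * v = h -
      (a1 * A * 'X_i + b4 * B * 'X_l - a3 * C * 'X_k + u * B * 'X_k) * 'X_j -
      (a4 * A * 'X_l + b1 * B * 'X_i) * 'X_k - (- a2 * D i l * 'X_i * 'X_l) * D j k.
    by rewrite Eh; ring.
  apply: line_eval_subM; last exact: coord_fermat12.
  apply: line_eval_subM; last exact: coord_X2.
  by apply: line_eval_subM; [exact: hjk | exact: coord_X1].
(* B X_j X_k is not a generator, but its multiples by X_i and X_l are multiples of B X_i X_k and B
   X_j X_l; likewise B X_i X_l times X_j or X_k. *)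
exists a1, a4, (b1 + e1 * 'X_j + e4 * 'X_l), (b4 + e2 * 'X_k + e3 * 'X_i), (- a2), (- a3).
by rewrite Eh Eu Ev; ring.
Qed.

(* B vanishes on none of the planes X_i = r X_j, X_k = r X_l whose union is A = 0. *)
Lemma fermat_regular e p q : A * p = B ^+ e * q -> exists q', q = A * q'.
Proof.
move=> E.
have [q1 Eq] : exists q1, q = D i j * q1.
  apply: fermat_plane_vanish => // r rs; apply: (@mulr_vanish _ _ i j r (B ^+ e)).
    rewrite rmorphXn rmorphM !rmorphB /= msubst_Xn // !msubst_Xn0 //.
    by rewrite expf_neq0 // mulf_neq0 ?fermat_neq0.
  by rewrite -E !rmorphM rmorphB /= msubst_Xn // msubst_Xn0 // subrr !mul0r.
have {E Eq} [E ->] : D k l * p = B ^+ e * q1 /\ q = D i j * q1.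
  split=> //; apply: (mulfI (fermat_neq0 ij)).
  by rewrite mulrA E Eq mulrCA.
have [q2 ->] : exists q2, q1 = D k l * q2.
  apply: fermat_plane_vanish => // r rs; apply: (@mulr_vanish _ _ k l r (B ^+ e)).
    rewrite rmorphXn rmorphM !rmorphB /= msubst_Xn // !msubst_Xn0 //.
    by rewrite expf_neq0 // mulf_neq0 ?fermat_neq0.
  by rewrite -E !rmorphM rmorphB /= msubst_Xn // msubst_Xn0 // subrr !mul0r.
by exists q2; rewrite mulrA.
Qed.

End FourVariables.
End FermatLines.

(** * Symbolic powers *)

Section MonomialDegree.
Variables (K : idomainType) (N : nat).
Implicit Types (f g : {mpoly K[N]}) (d e m : nat).

(** Membership in the d-th power of the ideal of all variables. Unlike homogeneity it passes to
    arbitrary multiples, so the cofactors in [pow2] may be inhomogeneous. *)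
Definition mdeg_ge d f := {in msupp f, forall mon, (d <= mdeg mon)%N}.

Lemma mdeg_geD d f g : mdeg_ge d f -> mdeg_ge d g -> mdeg_ge d (f + g).
Proof.
by move=> df dg mon /msuppD_le; rewrite mem_cat => /orP[/df|/dg].
Qed.

Lemma mdeg_geM d e f g : mdeg_ge d f -> mdeg_ge e g -> mdeg_ge (d + e) (f * g).
Proof.
move=> df eg mon /msuppM_le/allpairsP[[m1 m2] /= [/df d1 /eg d2 ->]].
by rewrite mdegD leq_add.
Qed.

Lemma pow2_mdeg_ge a b d m f : mdeg_ge d a -> mdeg_ge d b ->
  pow2 a b m f -> mdeg_ge (d * m) f.
Proof.
move=> da db; have dbX k : mdeg_ge (d * k) (b ^+ k).
  by elim: k => [|k IH]; rewrite ?muln0 // exprS mulnS; apply: mdeg_geM.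
elim: m f => [|m IH] f; first by rewrite muln0.
move=> [u [c [/IH du ->]]]; apply: mdeg_geD.
  by rewrite mulnS; apply: mdeg_geM.
by rewrite -[(d * m.+1)%N]add0n; apply: mdeg_geM.
Qed.

Lemma dhomog_mdeg_ge d f : f \is d.-homog -> mdeg_ge d f.
Proof. by move=> /dhomogP df mon /df/= ->. Qed.

Lemma pow2_dhomog_deg a b d m e f : a \is d.-homog -> b \is d.-homog ->
  pow2 a b m f -> f != 0 -> f \is e.-homog -> (d * m <= e)%N.
Proof.
move=> /dhomog_mdeg_ge da /dhomog_mdeg_ge db /(pow2_mdeg_ge da db) dm nz /dhomogP he.
by have lf := mlead_supp nz; rewrite -(he _ lf); apply: dm.
Qed.

End MonomialDegree.

Section SymbolicPowers.
Variables (K : fieldType) (N n : nat) (s : seq K).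
Local Notation R := {mpoly K[N]}.
Local Notation D i j := ('X_i ^+ n - 'X_j ^+ n : R).
Hypothesis n_gt0 : (0 < n)%N.
Hypothesis s_uniq : uniq s.
Hypothesis s_root : forall r, (r \in s) = (r ^+ n == 1).
Hypothesis Dprod : forall i k, D i k = \prod_(r <- s) ('X_i - r *: 'X_k).

(** * Fermat lines as associated primes *)

Lemma line_kernel_prime i j k a b : is_prime_ideal (fun h : R => line_eval i j k a b h = 0).
Proof.
split; [split; first exact: rmorph0 | split].
- by split=> [f g f0 g0|r f f0]; rewrite ?rmorphD ?rmorphM /= f0 ?g0 ?addr0 ?mulr0.
- by rewrite rmorph1; apply/eqP; rewrite oner_eq0.
- by move=> f g /eqP; rewrite rmorphM mulf_eq0 => /orP[] /eqP; [left | right].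
Qed.

Lemma line_evalX_neq0 i j k a b (p : 'I_N) : i != k -> j != k -> a \in s -> b \in s ->
  line_eval i j k a b 'X_p != 0.
Proof.
move=> ik jk /(root_neq0 n_gt0 s_root) a0 /(root_neq0 n_gt0 s_root) b0.
rewrite line_evalX //; case: ifP => _; first exact: scaled_var_neq0.
by case: ifP => _; [exact: scaled_var_neq0 | exact: mpolyX_neq0].
Qed.

Lemma line_eval_exp_neq0 i j k a b (f : R) e :
  line_eval i j k a b f != 0 -> line_eval i j k a b (f ^+ e) != 0.
Proof. by rewrite rmorphXn /=; apply: expf_neq0. Qed.

(** The factor X_p - r X_k is simple: where X_p = r X_k the other factors become (r - r') X_k with
    r' different from r. *)
Lemma fermat_factor p k r : r \in s ->
  exists2 U, D p k = ('X_p - r *: 'X_k) * U &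
    forall i j a b, i != k -> j != k -> line_eval i j k a b 'X_p = r *: 'X_k ->
      line_eval i j k a b U != 0.
Proof.
move=> rs; rewrite Dprod (big_rem r) //=; eexists; first reflexivity.
move=> i j a b ik jk Ep; rewrite rmorph_prod prodf_seq_neq0; apply/allP => r' /=.
rewrite mem_rem_uniq // inE => /andP[r'r _].
rewrite linearB linearZ /= Ep line_evalX // [k == i]eq_sym [k == j]eq_sym.
rewrite (negPf ik) (negPf jk) -scalerBl; apply: scaled_var_neq0.
by rewrite subr_eq0 eq_sym.
Qed.

(** Removing X_i - a X_k from the first given element of I and X_j - b X_k from the second leaves V1
    and V2, neither vanishing on the line. The two linear forms generate the prime of the line and
    each carries V1 V2 into I, while I vanishes on the line; so the prime is (I : V1 V2). *)
Lemma line_associated_prime (I : R -> Prop) i j k l a b : is_ideal I ->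
  i != j -> i != k -> j != k -> l != i -> l != j -> l != k -> a \in s -> b \in s ->
  I (D i k * D j l * 'X_i * 'X_k) -> I (D j k * D i l * 'X_j * 'X_k) ->
  (forall h, I h -> line_eval i j k a b h = 0) ->
  associated_prime I (fun h => line_eval i j k a b h = 0).
Proof.
move=> [I0 [ID IM]] ij ik jk li lj lk sa sb I1 I2 kerI.
split; first exact: line_kernel_prime.
have [U1 E1 nz1] := fermat_factor i k sa.
have [U2 E2 nz2] := fermat_factor j k sb.
have nzX (p : 'I_N) : line_eval i j k a b 'X_p != 0 by apply: line_evalX_neq0.
pose V1 := U1 * (D j l * 'X_i * 'X_k); pose V2 := U2 * (D i l * 'X_j * 'X_k).
exists (V1 * V2) => h; split=> [h0|/kerI].
  have [p [q Eh]] := line_eval_div i j k a b h; rewrite h0 add0r in Eh.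
  have -> : h * (V1 * V2) = p * V2 * (('X_i - a *: 'X_k) * U1 * D j l * 'X_i * 'X_k) +
      q * V1 * (('X_j - b *: 'X_k) * U2 * D i l * 'X_j * 'X_k).
    by rewrite Eh /V1 /V2; ring.
  by rewrite -E1 -E2; apply: ID; apply: IM.
rewrite mulrC; apply: line_evalM_eq0; apply: line_evalM_neq0.
  apply: line_evalM_neq0; first by apply: nz1; rewrite ?line_evalX ?eqxx.
  apply: line_evalM_neq0 => //; apply: line_evalM_neq0 => //.
  exact: (line_fermat24 n_gt0 s_root).
apply: line_evalM_neq0.
  by apply: nz2; rewrite ?line_evalX ?eqxx // eq_sym (negPf ij).
apply: line_evalM_neq0 => //; apply: line_evalM_neq0 => //.
exact: (line_fermat14 n_gt0 s_root).
Qed.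

Lemma fermat2_homog (p q p' q' : 'I_N) : D p q * D p' q' \is (2 * n).-homog.
Proof.
have homX (r : 'I_N) : ('X_r ^+ n : R) \is n.-homog.
  by rewrite -[X in X.-homog]mul1n; apply: dhomogMn; rewrite dhomogX /= mdeg1.
by rewrite mul2n -addnn; apply: dhomogM; apply: rpredB.
Qed.

(** * Both degree bounds for an ideal with these six generators *)

Section FourVariables.
Variables i j k l : 'I_N.
Hypotheses (ij : i != j) (ik : i != k) (il : i != l).
Hypotheses (jk : j != k) (jl : j != l) (kl : k != l).
Local Notation A := (D i j * D k l).
Local Notation B := (D i k * D j l).
Local Notation C := (D i l * D j k).

Let ji : j != i. Proof. by rewrite eq_sym. Qed.
Let ki : k != i. Proof. by rewrite eq_sym. Qed.
Let li : l != i. Proof. by rewrite eq_sym. Qed.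
Let kj : k != j. Proof. by rewrite eq_sym. Qed.
Let lj : l != j. Proof. by rewrite eq_sym. Qed.
Let lk : l != k. Proof. by rewrite eq_sym. Qed.

Variable I : R -> Prop.
Hypothesis I_ideal : is_ideal I.
Hypothesis I_gen : forall h, I h <-> exists c1 c2 c3 c4 c5 c6,
  h = c1 * (A * 'X_i * 'X_j) + c2 * (A * 'X_k * 'X_l) +
      c3 * (B * 'X_i * 'X_k) + c4 * (B * 'X_j * 'X_l) +
      c5 * (C * 'X_i * 'X_l) + c6 * (C * 'X_j * 'X_k).

Lemma fermat_ideal_sub h : I h -> exists p q, h = p * A + q * B.
Proof.
move=> /I_gen[c1 [c2 [c3 [c4 [c5 [c6 ->]]]]]].
exists (c1 * 'X_i * 'X_j + c2 * 'X_k * 'X_l - c5 * 'X_i * 'X_l - c6 * 'X_j * 'X_k).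
exists (c3 * 'X_i * 'X_k + c4 * 'X_j * 'X_l + c5 * 'X_i * 'X_l + c6 * 'X_j * 'X_k).
ring.
Qed.

Inductive triple_line : (R -> Prop) -> Prop :=
| Tijl a b of a \in s & b \in s : triple_line (fun h => line_eval i j l a b h = 0)
| Tikl a b of a \in s & b \in s : triple_line (fun h => line_eval i k l a b h = 0)
| Tjkl a b of a \in s & b \in s : triple_line (fun h => line_eval j k l a b h = 0)
| Tijk a b of a \in s & b \in s : triple_line (fun h => line_eval i j k a b h = 0).

(** This is the radicality of (A, B), in the form that [pow2_saturated] asks for. Conversely, any
    three of the four indices contain a pair from each of A and B. *)
Lemma triple_lineP h :
  (forall P, triple_line P -> P h) <-> exists p q, h = p * A + q * B.
Proof.
split=> [hP|[p [q ->]] _ [] a b sa sb].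
- apply: (four_triples_vanish n_gt0 s_uniq s_root Dprod) => // a b sa sb.
  + exact: (hP _ (Tijl sa sb)).
  + exact: (hP _ (Tikl sa sb)).
  + exact: (hP _ (Tjkl sa sb)).
  + exact: (hP _ (Tijk sa sb)).
- have -> : p * A + q * B = 0 - (- p * D k l) * D i j - (- q * D i k) * D j l by ring.
  apply: line_eval_subM; last exact: (line_fermat23 s_root).
  by apply: line_eval_subM; [exact: rmorph0 | exact: (line_fermat12 s_root)].
- have -> : p * A + q * B = 0 - (- p * D i j) * D k l - (- q * D j l) * D i k by ring.
  apply: line_eval_subM; last exact: (line_fermat12 s_root).
  by apply: line_eval_subM; [exact: rmorph0 | exact: (line_fermat23 s_root)].
- have -> : p * A + q * B = 0 - (- p * D i j) * D k l - (- q * D i k) * D j l by ring.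
  apply: line_eval_subM; last exact: (line_fermat13 s_root).
  by apply: line_eval_subM; [exact: rmorph0 | exact: (line_fermat23 s_root)].
- have -> : p * A + q * B = 0 - (- p * D k l) * D i j - (- q * D j l) * D i k by ring.
  apply: line_eval_subM; last exact: (line_fermat13 s_root).
  by apply: line_eval_subM; [exact: rmorph0 | exact: (line_fermat12 s_root)].
Qed.

Lemma triple_line_associated P : triple_line P -> associated_prime I P.
Proof.
have kerI P' h : triple_line P' -> I h -> P' h.
  by move=> LP /fermat_ideal_sub/triple_lineP; apply.
have gen c1 c2 c3 c4 c5 c6 : I (c1 * (A * 'X_i * 'X_j) + c2 * (A * 'X_k * 'X_l) +
      c3 * (B * 'X_i * 'X_k) + c4 * (B * 'X_j * 'X_l) +
      c5 * (C * 'X_i * 'X_l) + c6 * (C * 'X_j * 'X_k)).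
  by apply/I_gen; exists c1, c2, c3, c4, c5, c6.
case=> a b sa sb.
- apply: (@line_associated_prime I i j l k) => //.
  + by have := gen 0 0 0 0 1 0; congr I; ring.
  + by have := gen 0 0 0 1 0 0; congr I; ring.
  + by move=> h; apply: (kerI _ _ (Tijl sa sb)).
- apply: (@line_associated_prime I i k l j) => //.
  (* The sign comes from D_kj = - D_jk. *)
  + by have := gen 0 0 0 0 (-1) 0; congr I; ring.
  + by have := gen 0 1 0 0 0 0; congr I; ring.
  + by move=> h; apply: (kerI _ _ (Tikl sa sb)).
- apply: (@line_associated_prime I j k l i) => //.
  + by have := gen 0 0 0 (-1) 0 0; congr I; ring.
  + by have := gen 0 (-1) 0 0 0 0; congr I; ring.
  + by move=> h; apply: (kerI _ _ (Tjkl sa sb)).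
- apply: (@line_associated_prime I i j k l) => //.
  + by have := gen 0 0 1 0 0 0; congr I; ring.
  + by have := gen 0 0 0 0 0 1; congr I; ring.
  + by move=> h; apply: (kerI _ _ (Tijk sa sb)).
Qed.

Lemma symbolic_power_deg_ge m f e : symbolic_power I m f -> f != 0 ->
  f \is e.-homog -> (2 * n * m <= e)%N.
Proof.
move=> fm nz he.
apply: (pow2_dhomog_deg (fermat2_homog i j k l) (fermat2_homog i k j l) _ nz he).
apply: (@pow2_saturated _ triple_line).
- by apply: mulfI; rewrite mulf_neq0 ?fermat_neq0.
- by move=> P [] a b _ _; apply: line_kernel_prime.
- exact: triple_lineP.
- by move=> e' p q; apply: (fermat_regular n_gt0 s_uniq s_root Dprod).
move=> P /triple_line_associated/fm[t [Pt It]]; exists t => //.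
exact: ideal_pow_pow2 fermat_ideal_sub It.
Qed.

(* Let P = (I : g). If every t with t f in I^m were in P, then t g would be in I for
   all those t; since for each line some such t does not vanish on it, g would vanish
   on all lines, that is g would be in I. *)
Lemma symbolic_power_mem a b c m : (m = a + b + c)%N ->
  (m <= n * a)%N -> (m <= n * b)%N -> (m <= n * c)%N ->
  symbolic_power I m (A ^+ a * B ^+ b * C ^+ c).
Proof.
move=> Em ma mb mc P [[_ [P1 _]] [g Pg]]; set f := A ^+ a * _ * _.
apply: NNPP => noS; apply: P1; rewrite Pg mul1r.
have gI t : ideal_pow I m (t * f) -> I (t * g).
  by move=> Itf; apply/Pg; apply: NNPP => Pt; apply: noS; exists t.
have gen c1 c2 c3 c4 c5 c6 : I (c1 * (A * 'X_i * 'X_j) + c2 * (A * 'X_k * 'X_l) +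
      c3 * (B * 'X_i * 'X_k) + c4 * (B * 'X_j * 'X_l) +
      c5 * (C * 'X_i * 'X_l) + c6 * (C * 'X_j * 'X_k)).
  by apply/I_gen; exists c1, c2, c3, c4, c5, c6.
(* The coordinate line X_p = X_q = 0: if X_p t and X_q t are in I, then t^(n e) f is in I^m. So t^(n
   e) g is in I and vanishes on the line, whereas t does not. *)
have g_coord p q r t u e : (m <= n * e)%N -> f = D p q ^+ e * u ->
    I ('X_p * t) -> I ('X_q * t) -> p != r -> q != r ->
    (forall h, I h -> exists p1 p2 p3, h = p1 * D p q + p2 * 'X_p + p3 * 'X_q) ->
    line_eval p q r 0 0 t != 0 -> line_eval p q r 0 0 g = 0.
  move=> me Ef Ip Iq pr qr Ipq nzt.
  apply: (@line_evalM_eq0 _ _ p q r 0 0 (t ^+ (n * e))); first exact: line_eval_exp_neq0.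
  have /Ipq[p1 [p2 [p3 ->]]] : I (t ^+ (n * e) * g).
    apply: gI; rewrite Ef mulrA mulrC; apply: ideal_powMl.
    exact: ideal_pow_subXX.
  have -> : p1 * D p q + p2 * 'X_p + p3 * 'X_q =
      0 - (- p1) * D p q - (- p2) * 'X_p - (- p3) * 'X_q by ring.
  apply: line_eval_subM; last exact: coord_X2.
  apply: line_eval_subM; last exact: coord_X1.
  by apply: line_eval_subM; [exact: rmorph0 | exact: coord_fermat12].
(* Each equation moves the power of one chosen factor of A, B or C to the front of f. *)
have regroup2 (p q u v : R) e : (p * q) ^+ e * u * v = p ^+ e * (q ^+ e * u * v) /\
    (p * q) ^+ e * u * v = q ^+ e * (p ^+ e * u * v) /\
    u * (p * q) ^+ e * v = p ^+ e * (q ^+ e * u * v) /\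
    u * (p * q) ^+ e * v = q ^+ e * (p ^+ e * u * v) /\
    u * v * (p * q) ^+ e = p ^+ e * (q ^+ e * u * v) /\
    u * v * (p * q) ^+ e = q ^+ e * (p ^+ e * u * v).
  by rewrite !exprMn; do 5?split; ring.
apply/I_gen; apply: (fermat_lines_vanish n_gt0) => //.
- apply/triple_lineP => Q LQ.
  (* t f is a product of a + b + c = m generators A X_i X_j, B X_i X_k, C X_i X_l, and no variable
     vanishes on a Fermat line. *)
  pose t := ('X_i * 'X_j) ^+ a * ('X_i * 'X_k) ^+ b * ('X_i * 'X_l) ^+ c : R.
  have nzt p q r a' b' : p != r -> q != r -> a' \in s -> b' \in s ->
      line_eval p q r a' b' t != 0.
    move=> pr qr sa sb; have nzX o := line_evalX_neq0 o pr qr sa sb.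
    have nzXX o1 o2 e : line_eval p q r a' b' (('X_o1 * 'X_o2) ^+ e) != 0.
      by apply: line_eval_exp_neq0; apply: line_evalM_neq0.
    by apply: line_evalM_neq0; first apply: line_evalM_neq0.
  have {LQ} : triple_line Q /\ Q (t * g).
    split=> //; apply: (triple_lineP _).2 LQ; apply: fermat_ideal_sub; apply: gI.
    have regroup (x y z x' y' z' : R) : x ^+ a * y ^+ b * z ^+ c *
        (x' ^+ a * y' ^+ b * z' ^+ c) = (x * x') ^+ a * (y * y') ^+ b * (z * z') ^+ c.
      by rewrite !exprMn; ring.
    rewrite regroup Em; apply: ideal_powM; first apply: ideal_powM; apply: ideal_powXn.
    + by have := gen 1 0 0 0 0 0; congr I; ring.
    + by have := gen 0 0 1 0 0 0; congr I; ring.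
    + by have := gen 0 0 0 0 1 0; congr I; ring.
  by case=> -[] a' b' sa sb; apply: line_evalM_eq0; apply: nzt.
- split.
  (* B X_k X_l is nonzero on X_i = X_j = 0, and its products with X_i and X_j are multiples of B X_i
     X_k and B X_j X_l. The other five lines use B or A in the same way. *)
  - apply: (@g_coord i j k (B * ('X_k * 'X_l)) (D k l ^+ a * B ^+ b * C ^+ c) a) => //.
    + by have [E [_ [_ [_ [_ _]]]]] := regroup2 (D i j) (D k l) (B ^+ b) (C ^+ c) a.
    + by have := gen 0 0 'X_l 0 0 0; congr I; ring.
    + by have := gen 0 0 0 'X_k 0 0; congr I; ring.
    + move=> h /I_gen[c1 [c2 [c3 [c4 [c5 [c6 ->]]]]]].
      exists (c1 * D k l * 'X_i * 'X_j + c2 * D k l * 'X_k * 'X_l),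
        (c3 * B * 'X_k + c5 * C * 'X_l),
        (c4 * B * 'X_l + c6 * C * 'X_k).
      ring.
    + apply: line_evalM_neq0; last by apply: line_evalM_neq0; exact: line_X0_neq0.
      by apply: line_evalM_neq0; [exact: coord_fermat1_neq0 | exact: coord_fermat2_neq0].
  - apply: (@g_coord k l i (B * ('X_i * 'X_j)) (D i j ^+ a * B ^+ b * C ^+ c) a) => //.
    + by have [_ [E [_ [_ [_ _]]]]] := regroup2 (D i j) (D k l) (B ^+ b) (C ^+ c) a.
    + by have := gen 0 0 'X_j 0 0 0; congr I; ring.
    + by have := gen 0 0 0 'X_i 0 0; congr I; ring.
    + move=> h /I_gen[c1 [c2 [c3 [c4 [c5 [c6 ->]]]]]].
      exists (c1 * D i j * 'X_i * 'X_j + c2 * D i j * 'X_k * 'X_l),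
        (c3 * B * 'X_i + c6 * C * 'X_j),
        (c4 * B * 'X_j + c5 * C * 'X_i).
      ring.
    + apply: line_evalM_neq0; last by apply: line_evalM_neq0; exact: line_X0_neq0.
      by apply: line_evalM_neq0; [exact: coord_fermat1r_neq0 | exact: coord_fermat2r_neq0].
- split.
  - apply: (@g_coord i k j (A * ('X_j * 'X_l)) (D j l ^+ b * A ^+ a * C ^+ c) b) => //.
    + by have [_ [_ [E [_ [_ _]]]]] := regroup2 (D i k) (D j l) (A ^+ a) (C ^+ c) b.
    + by have := gen 'X_l 0 0 0 0 0; congr I; ring.
    + by have := gen 0 'X_j 0 0 0 0; congr I; ring.
    + move=> h /I_gen[c1 [c2 [c3 [c4 [c5 [c6 ->]]]]]].
      exists (c3 * D j l * 'X_i * 'X_k + c4 * D j l * 'X_j * 'X_l),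
        (c1 * A * 'X_j + c5 * C * 'X_l),
        (c2 * A * 'X_l + c6 * C * 'X_j).
      ring.
    + apply: line_evalM_neq0; last by apply: line_evalM_neq0; exact: line_X0_neq0.
      by apply: line_evalM_neq0; [exact: coord_fermat1_neq0 | exact: coord_fermat2_neq0].
  - apply: (@g_coord j l i (A * ('X_i * 'X_k)) (D i k ^+ b * A ^+ a * C ^+ c) b) => //.
    + by have [_ [_ [_ [E [_ _]]]]] := regroup2 (D i k) (D j l) (A ^+ a) (C ^+ c) b.
    + by have := gen 'X_k 0 0 0 0 0; congr I; ring.
    + by have := gen 0 'X_i 0 0 0 0; congr I; ring.
    + move=> h /I_gen[c1 [c2 [c3 [c4 [c5 [c6 ->]]]]]].
      exists (c3 * D i k * 'X_i * 'X_k + c4 * D i k * 'X_j * 'X_l),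
        (c1 * A * 'X_i + c6 * C * 'X_k),
        (c2 * A * 'X_k + c5 * C * 'X_i).
      ring.
    + apply: line_evalM_neq0; last by apply: line_evalM_neq0; exact: line_X0_neq0.
      by apply: line_evalM_neq0; [exact: coord_fermat1r_neq0 | exact: coord_fermat2r_neq0].
- split.
  - apply: (@g_coord i l j (A * ('X_j * 'X_k)) (D j k ^+ c * A ^+ a * B ^+ b) c) => //.
    + by have [_ [_ [_ [_ [E _]]]]] := regroup2 (D i l) (D j k) (A ^+ a) (B ^+ b) c.
    + by have := gen 'X_k 0 0 0 0 0; congr I; ring.
    + by have := gen 0 'X_j 0 0 0 0; congr I; ring.
    + move=> h /I_gen[c1 [c2 [c3 [c4 [c5 [c6 ->]]]]]].
      exists (c5 * D j k * 'X_i * 'X_l + c6 * D j k * 'X_j * 'X_k),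
        (c1 * A * 'X_j + c3 * B * 'X_k),
        (c2 * A * 'X_k + c4 * B * 'X_j).
      ring.
    + apply: line_evalM_neq0; last by apply: line_evalM_neq0; exact: line_X0_neq0.
      by apply: line_evalM_neq0; [exact: coord_fermat1_neq0 | exact: coord_fermat2r_neq0].
  - apply: (@g_coord j k i (A * ('X_i * 'X_l)) (D i l ^+ c * A ^+ a * B ^+ b) c) => //.
    + by have [_ [_ [_ [_ [_ E]]]]] := regroup2 (D i l) (D j k) (A ^+ a) (B ^+ b) c.
    + by have := gen 'X_l 0 0 0 0 0; congr I; ring.
    + by have := gen 0 'X_i 0 0 0 0; congr I; ring.
    + move=> h /I_gen[c1 [c2 [c3 [c4 [c5 [c6 ->]]]]]].
      exists (c5 * D i l * 'X_i * 'X_l + c6 * D i l * 'X_j * 'X_k),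
        (c1 * A * 'X_i + c4 * B * 'X_l),
        (c2 * A * 'X_l + c3 * B * 'X_i).
      ring.
    + apply: line_evalM_neq0; last by apply: line_evalM_neq0; exact: line_X0_neq0.
      by apply: line_evalM_neq0; [exact: coord_fermat1r_neq0 | exact: coord_fermat2_neq0].
Qed.

End FourVariables.
End SymbolicPowers.

(** * The ideal I_n over the complex numbers *)

Lemma I_nP n h : let D (i j : 'I_4) : Rxyzw := 'X_i ^+ n - 'X_j ^+ n in
  I_n n h <-> exists c1 c2 c3 c4 c5 c6 : Rxyzw,
  h = c1 * (D 0 1 * D 2 3 * 'X_0 * 'X_1) + c2 * (D 0 1 * D 2 3 * 'X_2 * 'X_3) +
      c3 * (D 0 2 * D 1 3 * 'X_0 * 'X_2) + c4 * (D 0 2 * D 1 3 * 'X_1 * 'X_3) +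
      c5 * (D 0 3 * D 1 2 * 'X_0 * 'X_3) + c6 * (D 0 3 * D 1 2 * 'X_1 * 'X_2).
Proof. exact: ideal_of_seq6. Qed.

Theorem theorem3p2 (n : nat) : leq 5 n ->
  forall m : nat, leq 3 m ->
  alpha_is (@symbolic_power Rxyzw (I_n n) m) (2 * n * m).
Proof.
move=> n5 m m3; have n_gt0 : (0 < n)%N by apply: leq_trans n5.
have [|s [us rs prs]] := @roots_of_unity (complex Rdefinitions.R) n.
  by rewrite Num.Theory.pnatr_eq0 -lt0n.
have idI : is_ideal (I_n n) by apply: ideal_gen_is_ideal.
split; last first.
  move=> f e If nz he.
  exact: (@symbolic_power_deg_ge _ _ _ _ n_gt0 us rs (prs 4%N) 0 1 2 3 isT isT isT isT
    isT isT _ idI (I_nP n) _ _ _ If nz he).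
pose a := (m - 2 * (m %/ 3))%N; pose b := (m %/ 3)%N.
have [Em nb ba] : [/\ m = (a + b + b)%N, (m <= n * b)%N & (b <= a)%N].
  (* m <= 3 b + 2 <= 5 b, since m >= 3 gives b >= 1; equality occurs at m = 5. *)
  have m5 : (m <= 5 * b)%N by rewrite /b; lia.
  split; rewrite /a /b; try lia.
  by apply: leq_trans m5 _; rewrite leq_mul2r n5 orbT.
have na : (m <= n * a)%N by apply: (leq_trans nb); rewrite leq_mul2l ba orbT.
pose D (i j : 'I_4) : Rxyzw := 'X_i ^+ n - 'X_j ^+ n.
exists ((D 0 1 * D 2 3) ^+ a * (D 0 2 * D 1 3) ^+ b * (D 0 3 * D 1 2) ^+ b).
have Dnz i j : i != j -> D i j != 0 by apply: fermat_neq0.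
split; last split.
- exact: (@symbolic_power_mem _ _ _ _ n_gt0 us rs (prs 4%N) 0 1 2 3 isT isT isT isT
    isT isT _ (I_nP n) _ _ _ _ Em na nb nb).
- by do !apply: mulf_neq0; apply: expf_neq0; apply: mulf_neq0; apply: Dnz.
rewrite Em !mulnDr.
by apply: dhomogM; first apply: dhomogM; apply: dhomogMn; apply: fermat2_homog.
Qed.
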